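(* Let $(a_n)_{n\geq 0}$ be a sequence of positive real numbers such that $a_0=1$, $a_{i+j}\leq a_ia_j$ for all integers $i,j\geq 0$, and $\lim_{n\to\infty}a_n^{1/n}=r>0$. For each $i\in\mathbb{Z}$ let $C_i=\sup\{a_{m+i}/a_m : m\geq 0,\ m+i\geq 0\}\in(0,\infty]$. Then there exists an element $x$ in some Banach algebra with $\lVert x^n\rVert=a_n$ for all $n\geq 0$ and spectrum equal to the circle $\{\lambda\in\mathbb{C}:|\lambda|=r\}$ if and only if $C_{-1}$ is finite and $\inf_{k>0}C_{-k}^{1/k}=\frac{1}{r}$, where the infimum is over positive integers $k$.
   Context: Banach algebras are complex and unital, with submultiplicative norm and $\lVert 1\rVert=1$. The spectrum of $x$ is $\{\lambda\in\mathbb{C}:\lambda\cdot 1-x\text{ is not invertible}\}$. *)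

(* Defs.v *)
From HB Require Import structures.
From mathcomp Require Import all_boot all_order all_algebra.
From mathcomp Require Import complex.
From mathcomp Require Import all_classical all_reals all_analysis.

Set Implicit Arguments.
Unset Strict Implicit.
Unset Printing Implicit Defensive.

Import Order.TTheory GRing.Theory Num.Theory.
Import numFieldNormedType.Exports.

Local Open Scope classical_set_scope.
Local Open Scope complex_scope.
Local Open Scope ring_scope.

(* The hierarchy admits no common substructure of rings and normed modules
   below numDomainType (Hierarchy Builder rejects the missing join), so the
   multiplication is a field of the mixin, and banachAlgType K is equipped with
   its algType K instance afterwards.  Norms take values in K: for K = R[i] they
   are elements x%:C with x >= 0 in R. *)
HB.mixin Record CompleteNormedModule_isBanachAlgebra (K : numFieldType) A
    of CompleteNormedModule K A := {
  banach_one : A ;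
  banach_mul : A -> A -> A ;
  banach_mulA : associative banach_mul ;
  banach_mul1r : left_id banach_one banach_mul ;
  banach_mulr1 : right_id banach_one banach_mul ;
  banach_mulDl : left_distributive banach_mul +%R ;
  banach_mulDr : right_distributive banach_mul +%R ;
  banach_scalerAl : forall (k : K) (x y : A),
    k *: banach_mul x y = banach_mul (k *: x) y ;
  banach_scalerAr : forall (k : K) (x y : A),
    k *: banach_mul x y = banach_mul x (k *: y) ;
  banach_norm_mul : forall x y : A, `|banach_mul x y| <= `|x| * `|y| ;
  banach_norm_one : `|banach_one| = 1
}.

#[short(type="banachAlgType")]
HB.structure Definition BanachAlgebra (K : numFieldType) :=
  {A of CompleteNormedModule K A & CompleteNormedModule_isBanachAlgebra K A}.

Lemma banach_one_neq0 (K : numFieldType) (A : banachAlgType K) :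
  banach_one != 0 :> A.
Proof.
apply/eqP => e; have := @banach_norm_one K A.
by rewrite e normr0 => /eqP; rewrite eq_sym oner_eq0.
Qed.

#[non_forgetful_inheritance]
HB.instance Definition _ (K : numFieldType) (A : banachAlgType K) :=
  GRing.Zmodule_isNzRing.Build (BanachAlgebra.sort A)
    (@banach_mulA K A) (@banach_mul1r K A) (@banach_mulr1 K A)
    (@banach_mulDl K A) (@banach_mulDr K A) (@banach_one_neq0 K A).

#[non_forgetful_inheritance]
HB.instance Definition _ (K : numFieldType) (A : banachAlgType K) :=
  GRing.Lmodule_isLalgebra.Build K (BanachAlgebra.sort A)
    (@banach_scalerAl K A).

#[non_forgetful_inheritance]
HB.instance Definition _ (K : numFieldType) (A : banachAlgType K) :=
  GRing.Lalgebra_isAlgebra.Build K (BanachAlgebra.sort A)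
    (@banach_scalerAr K A).

Definition invertible (A : pzRingType) (x : A) : Prop :=
  exists y : A, x * y = 1 /\ y * x = 1.

Definition spectrum (K : numFieldType) (A : banachAlgType K) (x : A) : set K :=
  [set l : K | ~ invertible (l *: 1 - x)].

(* C_i, a supremum in the extended reals; m + i is an integer, so m + i >= 0 is
   a genuine restriction on m when i < 0. *)
Definition shift_sup (R : realType) (a : nat -> R) (i : int) : \bar R :=
  ereal_sup [set (a `|(m%:Z + i)%R|%N / a m)%:E | m in [set m : nat | 0 <= m%:Z + i]].

(* Main.v *)
Require Import Defs.
From HB Require Import structures.
From mathcomp Require Import all_boot all_order all_algebra.
From mathcomp Require Import complex.
From mathcomp Require Import all_classical all_reals all_analysis.
From mathcomp Require Import lra zify.
Import Order.TTheory GRing.Theory Num.Theory.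
Import numFieldNormedType.Exports.
Local Open Scope classical_set_scope.
Local Open Scope complex_scope.
Local Open Scope ring_scope.

Set Implicit Arguments.
Unset Strict Implicit.
Unset Printing Implicit Defensive.

(** Why the theorem is true.

    Suppose that [x] has norms [a n] and spectrum the circle of radius [r].
    Since [0] is off the circle, [x] has an inverse [y], and
    [x ^ m = y ^ k x ^ (m + k)] gives [a m <= |y ^ k| a (m + k)], that is
    [C_(-k) <= |y ^ k|].  So [C_(-1)] is finite.  For [|l| < r] the element
    [1 - l y = (x - l) y] is invertible, so the spectral radius of [y] is at
    most [1 / r] and some power satisfies [rho ^ n |y ^ n| <= 1] as soon as
    [rho < r] ([spectral_radius_le]); hence [inf C_(-k) ^ (1/k) <= 1 / r].
    The reverse inequality holds whether or not [x] exists: iterating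
    [a m <= C_(-k) a (m + k)] bounds [a (k j)] below by [C_(-k) ^ (- j)], and
    [a (k j) ^ (1 / (k j))] tends to [r] ([shift_sup_ge]).

    The spectral radius is bounded without contour integrals.  The resolvent
    [l |-> (1 - l y)^-1] is bounded on a closed disc, by compactness, hence
    Lipschitz there.  Its average over the points [w l], for [w ^ N = 1] with
    [N = 2 ^ n], is the inverse of [1 - l ^ N y ^ N], and
    averaging keeps the Lipschitz constant, whatever [N].  So the property that
    some [t ^ N |y ^ N|] is small propagates from [t] to [t + h] with a fixed
    step [h], from [t = 0] to the boundary of the disc.

    Conversely, assume the two conditions.  The numbers [C_i], with [i] in Z,
    are submultiplicative, extend the sequence [a], and satisfy [r ^ i <= C_i].
    Let [E] be the space of the functions [f : Z -> C] with
    [|f i| <= M C_i] for some [M], normed by the least such [M], and let [S] be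
    the translation [(S f) i = f (i + 1)], in the Banach algebra of bounded
    operators of [E].  Then [S ^ j] has norm exactly [C_j] (test it on the
    weight itself), which is [a j] when [j >= 0].  If [|l| = r], then
    [i |-> l ^ i] belongs to [E] and is an eigenvector of [S].  If [|l| > r],
    then some power of [S / l] has norm less than [1]; if [|l| < r], the
    condition on the infimum says the same of [l S^-1].  In both cases the
    Neumann series inverts [l - S] ([wshift_spectrum]).

    Both [E] and its algebra of operators are spaces of functions dominated by
    a weight, the second one with weight [|f|] on [E]; completeness is proved
    once, for such spaces in general ([domfun_cauchy_cvg]). *)

(** * Norms with values in the real numbers *)

Section RealNorm.
Variables (R : realType) (V : normedZmodType R[i]).
Implicit Types u v : V.

(** A norm over [R[i]] takes its values in [R[i]], which is only partially
    ordered; infima and linear arithmetic need the same norm with values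
    in [R]. *)
Definition rnorm v : R := complex.Re `|v|.

Lemma rnormE v : `|v| = (rnorm v)%:C.
Proof. by rewrite /rnorm RRe_real// ger0_real. Qed.

Lemma rnorm_ge0 v : 0 <= rnorm v.
Proof. by rewrite -lecR -rnormE; exact: normr_ge0. Qed.

Lemma rnorm_le v (M : R) : (rnorm v <= M) = (`|v| <= M%:C).
Proof. by rewrite rnormE lecR. Qed.

Lemma rnorm_lt v (M : R) : (rnorm v < M) = (`|v| < M%:C).
Proof. by rewrite rnormE ltcR. Qed.

Lemma rnormD u v : rnorm (u + v) <= rnorm u + rnorm v.
Proof. by rewrite rnorm_le rmorphD/= -!rnormE ler_normD. Qed.

Lemma rnormN v : rnorm (- v) = rnorm v.
Proof. by rewrite /rnorm normrN. Qed.

Lemma rnormBC u v : rnorm (u - v) = rnorm (v - u).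
Proof. by rewrite /rnorm distrC. Qed.

Lemma rnormB u v : rnorm (u - v) <= rnorm u + rnorm v.
Proof. by rewrite -(rnormN v) rnormD. Qed.

Lemma rnorm0 : rnorm 0 = 0.
Proof. by rewrite /rnorm normr0. Qed.

Lemma rnorm0_eq0 v : rnorm v = 0 -> v = 0.
Proof. by move=> v0; apply/normr0_eq0; rewrite rnormE v0. Qed.

Lemma rnorm_sum (I : Type) (s : seq I) (f : I -> V) :
  rnorm (\sum_(i <- s) f i) <= \sum_(i <- s) rnorm (f i).
Proof.
elim/big_ind2 : _ => [|u x v y ux vy|//]; first by rewrite rnorm0.
exact: le_trans (rnormD _ _) (lerD ux vy).
Qed.

Lemma ler_rnorm_dist u v : rnorm u - rnorm v <= rnorm (u - v).
Proof. by rewrite lerBlDr -{1}(subrK v u) rnormD. Qed.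

End RealNorm.

Lemma rnormZ (R : realType) (V : normedModType R[i]) (k : R[i]) (v : V) :
  rnorm (k *: v) = rnorm k * rnorm v.
Proof. by apply: complexI; rewrite -rnormE normrZ !rnormE rmorphM. Qed.

Lemma rnormM (R : realType) (k l : R[i]) : rnorm (k * l) = rnorm k * rnorm l.
Proof. by apply: complexI; rewrite -rnormE normrM !rnormE rmorphM. Qed.

Lemma rnormX (R : realType) (k : R[i]) n : rnorm (k ^+ n) = rnorm k ^+ n.
Proof. by apply: complexI; rewrite -rnormE normrX rnormE rmorphXn. Qed.

Lemma rnormV (R : realType) (k : R[i]) : rnorm k^-1 = (rnorm k)^-1.
Proof. by apply: complexI; rewrite -rnormE normfV rnormE fmorphV. Qed.

Lemma rnormXz (R : realType) (k : R[i]) (i : int) : rnorm (k ^ i) = rnorm k ^ i.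
Proof. by case: i => n; rewrite ?NegzE -?exprnN ?rnormV rnormX. Qed.

Lemma rnorm_real (R : realType) (t : R) : rnorm t%:C = `|t|.
Proof. by rewrite /rnorm normc_def/= expr0n addr0 sqrtr_sqr. Qed.

Lemma gt0_complexP (R : realType) (e : R[i]) :
  0 < e -> exists2 d : R, 0 < d & e = d%:C.
Proof.
move=> e0; exists (complex.Re e); last by rewrite RRe_real// gtr0_real.
by rewrite -ltcR RRe_real// gtr0_real.
Qed.

Lemma cvg_rnormP (R : realType) (T : Type) (F : set_system T) {FF : Filter F}
    (V : normedModType R[i]) (f : T -> V) (v : V) :
  f @ F --> v <-> forall e : R, 0 < e -> \forall t \near F, rnorm (v - f t) < e.
Proof.
split=> [/cvgrPdist_lt fv e e0|fv].
  have /fv : 0 < e%:C by rewrite ltcR.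
  by apply: filterS => t; rewrite -rnorm_lt.
apply/cvgrPdist_lt => _ /gt0_complexP[e e0 ->].
by apply: filterS (fv _ e0) => t; rewrite -rnorm_lt.
Qed.

Lemma cauchy_rnormP (R : realType) (V : normedModType R[i]) (F : set_system V)
    {FF : ProperFilter F} :
  cauchy F <->
  forall e : R, 0 < e -> exists v, \forall w \near F, rnorm (v - w) < e.
Proof.
split=> [/cauchyP Fc e e0|Fc].
  have [|v Fv] := Fc e%:C; first by rewrite ltcR.
  by exists v; apply: filterS Fv => w; rewrite -ball_normE/= -rnorm_lt.
apply/cauchyP => _ /gt0_complexP[e e0 ->]; have [v Fv] := Fc _ e0.
by exists v; apply: filterS Fv => w; rewrite -ball_normE/= -rnorm_lt.
Qed.

(** * The complex plane is complete *)

Section ComplexComplete.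
Variable R : realType.

Lemma Re_le_rnorm (z : R[i]) : `|complex.Re z| <= rnorm z.
Proof. by rewrite -lecR -rnormE normc_ge_Re. Qed.

Lemma rnorm_i : rnorm ('i%C : R[i]) = 1.
Proof. by rewrite /rnorm normc_def/= expr0n add0r expr1n sqrtr1. Qed.

Lemma Im_le_rnorm (z : R[i]) : `|complex.Im z| <= rnorm z.
Proof.
by have := Re_le_rnorm (z * 'i%C); rewrite ReiNIm normrN rnormM rnorm_i mulr1.
Qed.

Lemma rnorm_le_ReIm (z : R[i]) : rnorm z <= `|complex.Re z| + `|complex.Im z|.
Proof.
rewrite {1}(complexE z) (le_trans (rnormD _ _))// rnormM !rnorm_real.
by rewrite rnorm_i mul1r.
Qed.

(** The real and imaginary parts are 1-Lipschitz and control the norm, so they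
    transport the completeness of [R]. *)
Lemma complex_cauchy_cvg (F : set_system R[i]^o) :
  ProperFilter F -> cauchy F -> cvg F.
Proof.
move=> FF /cauchy_rnormP Fc.
have part (p : R[i] -> R) : {morph p : x y / x - y} ->
    (forall z, `|p z| <= rnorm z) -> cvg (p @ F).
  move=> pB ple; apply: cauchy_cvg; apply/cauchyP => e e0.
  have [z Fz] := Fc _ e0; exists (p z).
  suff : F (p @^-1` ball (p z) e) by [].
  apply: filterS Fz => y zy; rewrite /= -ball_normE/= -pB.
  exact: le_lt_trans (ple _) zy.
have ReB : {morph @complex.Re R : x y / x - y} by move=> [? ?] [? ?].
have ImB : {morph @complex.Im R : x y / x - y} by move=> [? ?] [? ?].
have /cvg_ex[a Fa] := part _ ReB Re_le_rnorm.
have /cvg_ex[b Fb] := part _ ImB Im_le_rnorm.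
apply/cvg_ex; exists (a +i* b).
apply/(@cvg_rnormP R _ F _ _ id) => e e0.
have e20 : 0 < e / 2 by rewrite divr_gt0.
move/cvgrPdist_lt : Fa => /(_ _ e20) Fa.
move/cvgrPdist_lt : Fb => /(_ _ e20) Fb.
near=> z; rewrite (le_lt_trans (rnorm_le_ReIm _))//.
rewrite (splitr e) ReB ImB ltrD//=.
- by near: z.
- by near: z.
Unshelve. all: by end_near. Qed.

End ComplexComplete.

(** A copy of [R[i]^o]: the complete structure of a regular module [T^o] is
    inferred from [T : realType], so [R[i]^o] cannot receive its own. *)
Definition cplane (R : realType) : Type := R[i]^o.

HB.instance Definition _ (R : realType) := NormedModule.copy (cplane R) R[i]^o.

HB.instance Definition _ (R : realType) :=
  Uniform_isComplete.Build (cplane R) (@complex_cauchy_cvg R).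

(** * Spaces of functions dominated by a weight *)

(** The data of a Banach space of functions [X -> V]: a weight, and a linear
    condition closed under pointwise limits.  Weighted spaces of sequences
    take the trivial condition; bounded operators of [V] are the case [X = V],
    with weight the norm and linearity as the condition. *)
Record domspace (R : realType) (X : Type) (V : completeNormedModType R[i]) :=
  DomSpace {
    weight : X -> R ;
    weight_ge0 : forall x, 0 <= weight x ;
    admissible : set (X -> V) ;
    admissible0 : admissible (fun=> 0) ;
    admissible_lin : forall (k : R[i]) (f g : X -> V),
      admissible f -> admissible g -> admissible (fun x => k *: f x + g x) ;
    admissible_lim : forall (F : set_system (X -> V)) (g : X -> V),
      ProperFilter F -> F admissible ->
      (forall x, (fun f : X -> V => f x) @ F --> g x) -> admissible g
  }.

Record domfun (R : realType) (X : Type) (V : completeNormedModType R[i])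
    (D : domspace X V) := DomFun {
  domfun_fun :> X -> V ;
  domfun_adm : admissible D domfun_fun ;
  domfun_bound : exists2 M : R, 0 <= M &
    forall x, rnorm (domfun_fun x) <= M * weight D x
}.

Section DomFun.
Variables (R : realType) (X : Type) (V : completeNormedModType R[i]).
Variable D : domspace X V.
Implicit Types f g : domfun D.

Lemma domfunP f g : (forall x, f x = g x) -> f = g.
Proof.
move=> /funext; case: f g => [f fa fb] [g ga gb] /= fg.
by subst g; congr DomFun; exact: Prop_irrelevance.
Qed.

HB.instance Definition _ := gen_eqMixin (domfun D).
HB.instance Definition _ := gen_choiceMixin (domfun D).

Fact domfun0_bound :
  exists2 M : R, 0 <= M & forall x, rnorm (0 : V) <= M * weight D x.
Proof. by exists 0 => // x; rewrite rnorm0 mul0r. Qed.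

Fact domfun_lin_bound (k : R[i]) f g :
  exists2 M : R, 0 <= M & forall x, rnorm (k *: f x + g x) <= M * weight D x.
Proof.
have [M M0 fM] := domfun_bound f; have [N N0 gN] := domfun_bound g.
exists (rnorm k * M + N) => [|x].
  by rewrite addr_ge0// mulr_ge0// rnorm_ge0.
rewrite (le_trans (rnormD _ _))// mulrDl lerD// rnormZ -mulrA.
by rewrite ler_wpM2l// rnorm_ge0.
Qed.

Definition domfun_zero : domfun D := DomFun (admissible0 D) domfun0_bound.

Definition domfun_lin (k : R[i]) f g : domfun D :=
  DomFun (admissible_lin k (domfun_adm f) (domfun_adm g))
    (domfun_lin_bound k f g).

Definition domfun_add f g := domfun_lin 1 f g.
Definition domfun_scale k f := domfun_lin k f domfun_zero.
Definition domfun_opp f := domfun_scale (- 1) f.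

Lemma domfun_addE f g x : domfun_add f g x = f x + g x.
Proof. by rewrite /= scale1r. Qed.

Lemma domfun_scaleE k f x : domfun_scale k f x = k *: f x.
Proof. by rewrite /= addr0. Qed.

Lemma domfun_oppE f x : domfun_opp f x = - f x.
Proof. by rewrite domfun_scaleE scaleN1r. Qed.

Fact domfun_addA : associative domfun_add.
Proof. by move=> f g h; apply: domfunP => x; rewrite !domfun_addE addrA. Qed.

Fact domfun_addC : commutative domfun_add.
Proof. by move=> f g; apply: domfunP => x; rewrite !domfun_addE addrC. Qed.

Fact domfun_add0 : left_id domfun_zero domfun_add.
Proof. by move=> f; apply: domfunP => x; rewrite domfun_addE add0r. Qed.

Fact domfun_addN : left_inverse domfun_zero domfun_opp domfun_add.
Proof.
by move=> f; apply: domfunP => x; rewrite domfun_addE domfun_oppE addNr.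
Qed.

HB.instance Definition _ := GRing.isZmodule.Build (domfun D)
  domfun_addA domfun_addC domfun_add0 domfun_addN.

Fact domfun_scaleA k l f :
  domfun_scale k (domfun_scale l f) = domfun_scale (k * l) f.
Proof. by apply: domfunP => x; rewrite !domfun_scaleE scalerA. Qed.

Fact domfun_scale1 : left_id 1 domfun_scale.
Proof. by move=> f; apply: domfunP => x; rewrite domfun_scaleE scale1r. Qed.

Fact domfun_scaleDr : right_distributive domfun_scale +%R.
Proof.
move=> k f g; apply: domfunP => x.
by rewrite domfun_scaleE !domfun_addE !domfun_scaleE scalerDr.
Qed.

Fact domfun_scaleDl f : {morph domfun_scale^~ f : k l / k + l}.
Proof.
move=> k l; apply: domfunP => x.
by rewrite !domfun_addE !domfun_scaleE scalerDl.
Qed.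

HB.instance Definition _ := GRing.Zmodule_isLmodule.Build R[i] (domfun D)
  domfun_scaleA domfun_scale1 domfun_scaleDr domfun_scaleDl.

Lemma domfunD f g x : (f + g) x = f x + g x.
Proof. exact: domfun_addE. Qed.

Lemma domfunZ k f x : (k *: f) x = k *: f x.
Proof. exact: domfun_scaleE. Qed.

Lemma domfunN f x : (- f) x = - f x.
Proof. exact: domfun_oppE. Qed.

Lemma domfunB f g x : (f - g) x = f x - g x.
Proof. by rewrite domfunD domfunN. Qed.

(** The least [M] with [|f x| <= M * weight D x] for all [x].  It is an infimum
    of bounds, not a supremum of quotients: the weight may vanish. *)
Definition domnorm f : R :=
  inf [set M | 0 <= M /\ forall x, rnorm (f x) <= M * weight D x].

Let bounds_has_inf f :
  has_inf [set M | 0 <= M /\ forall x, rnorm (f x) <= M * weight D x].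
Proof.
split; first by have [M M0 fM] := domfun_bound f; exists M.
by exists 0 => M [].
Qed.

Lemma domnorm_ge0 f : 0 <= domnorm f.
Proof. by apply: lb_le_inf; [case: (bounds_has_inf f)|move=> M []]. Qed.

Lemma domnorm_le f M : 0 <= M ->
  (forall x, rnorm (f x) <= M * weight D x) -> domnorm f <= M.
Proof. by move=> M0 fM; apply: ge_inf; [case: (bounds_has_inf f)|split]. Qed.

Lemma domnormP f x : rnorm (f x) <= domnorm f * weight D x.
Proof.
have [w0|w0] := eqVneq (weight D x) 0.
  by have [M M0 /(_ x)] := domfun_bound f; rewrite w0 !mulr0.
have {}w0 : 0 < weight D x by rewrite lt0r w0 weight_ge0.
rewrite -ler_pdivrMr//; apply: lb_le_inf; first by case: (bounds_has_inf f).
by move=> M [_ /(_ x)]; rewrite ler_pdivrMr.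
Qed.

Fact domnormD f g : domnorm (f + g) <= domnorm f + domnorm g.
Proof.
apply: domnorm_le => [|x]; first by rewrite addr_ge0 ?domnorm_ge0.
by rewrite domfunD (le_trans (rnormD _ _))// mulrDl lerD// domnormP.
Qed.

Fact domnorm0_eq0 f : domnorm f = 0 -> f = 0.
Proof.
move=> f0; apply: domfunP => x; apply: rnorm0_eq0; apply/le_anti.
by rewrite rnorm_ge0 (le_trans (domnormP _ _))// f0 mul0r.
Qed.

Fact domnormZ k f : domnorm (k *: f) = rnorm k * domnorm f.
Proof.
apply/le_anti/andP; split.
  apply: domnorm_le => [|x]; first by rewrite mulr_ge0 ?rnorm_ge0 ?domnorm_ge0.
  by rewrite domfunZ rnormZ -mulrA ler_wpM2l ?rnorm_ge0 ?domnormP.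
have [k0|k0] := eqVneq (rnorm k) 0; first by rewrite k0 mul0r domnorm_ge0.
have {}k0 : 0 < rnorm k by rewrite lt0r k0 rnorm_ge0.
rewrite -ler_pdivlMl//; apply: domnorm_le => [|x].
  by rewrite mulr_ge0 ?invr_ge0 ?rnorm_ge0 ?domnorm_ge0.
by rewrite -mulrA ler_pdivlMl// -rnormZ -domfunZ domnormP.
Qed.

Let domnormDC f g :
  (domnorm (f + g))%:C <= (domnorm f)%:C + (domnorm g)%:C.
Proof. by rewrite -rmorphD lecR domnormD. Qed.

Let domnormZC k f : (domnorm (k *: f))%:C = `|k| * (domnorm f)%:C.
Proof. by rewrite domnormZ rmorphM/= -rnormE. Qed.

Let domnormC0 f : (domnorm f)%:C = 0 -> f = 0.
Proof. by move/complexI/domnorm0_eq0. Qed.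

HB.instance Definition _ := Lmodule_isNormed.Build R[i] (domfun D)
  domnormDC domnormZC domnormC0.

Lemma rnorm_domfun f : rnorm f = domnorm f.
Proof. by []. Qed.

End DomFun.

Section DomFunComplete.
Variables (R : realType) (X : Type) (V : completeNormedModType R[i]).
Variable D : domspace X V.

(** Evaluations are Lipschitz, so a Cauchy filter has pointwise limits.  The
    limit is admissible by closedness, and an estimate [|f - h| < e] passes to
    the limit in [h] at each point, hence uniformly relative to the weight. *)
Fact domfun_cauchy_cvg (F : set_system (domfun D)) :
  ProperFilter F -> cauchy F -> cvg F.
Proof.
move=> FF /cauchy_rnormP Fc.
pose ev x (f : domfun D) : V := f x.
have evF x : exists v : V, ev x @ F --> v.
  apply/cvg_ex; apply: cauchy_cvg; apply/cauchy_rnormP => e e0.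
  (* the [+ 1] keeps the divisor positive where the weight vanishes *)
  have w1 : 0 < weight D x + 1 by rewrite ltr_wpDl// weight_ge0.
  have [f Ff] := Fc (e / (weight D x + 1)) (divr_gt0 e0 w1).
  exists (f x); suff : F (ev x @^-1` [set v | rnorm (f x - v) < e]) by [].
  apply: filterS Ff => h /= fh.
  rewrite -domfunB (le_lt_trans (domnormP _ _))//.
  move: fh; rewrite rnorm_domfun ltr_pdivlMr//; apply: le_lt_trans.
  by rewrite ler_wpM2l ?domnorm_ge0// lerDl.
have [g Fg] := choice evF.
have near_g (f : domfun D) (e : R) : F [set h | rnorm (f - h) < e] ->
    forall x, rnorm (f x - g x) <= e * weight D x.
  move=> Ff x; apply/ler_addgt0Pr => d d0.
  have /cvg_rnormP/(_ _ d0) Fx := Fg x.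
  have [h [/= hf hg]] := filter_ex (filterI Ff Fx).
  have -> : f x - g x = (f - h) x - (g x - h x).
    by rewrite domfunB opprB addrA subrK.
  rewrite (le_trans (rnormB _ _))// lerD//; last exact: ltW.
  by rewrite (le_trans (domnormP _ _))// ler_wpM2r ?weight_ge0 ?ltW.
have g_adm : admissible D g.
  apply: (@admissible_lim _ _ _ D ((fun f : domfun D => f : X -> V) @ F)) => //.
  by rewrite /nbhs/=; apply: nearW => f; exact: domfun_adm.
have g_bound :
    exists2 M : R, 0 <= M & forall x, rnorm (g x) <= M * weight D x.
  have [f Ff] := Fc 1 ltr01; exists (rnorm f + 1) => [|x].
    by rewrite addr_ge0 ?rnorm_ge0.
  have -> : g x = f x - (f x - g x) by rewrite opprB addrC subrK.
  rewrite (le_trans (rnormB _ _))// mulrDl lerD ?near_g//.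
  exact: domnormP.
apply/cvg_ex; exists (DomFun g_adm g_bound).
apply/(@cvg_rnormP R _ F _ _ id) => e e0.
have e20 : 0 < e / 2 by rewrite divr_gt0.
have [f Ff] := Fc _ e20.
apply: filterS (Ff) => h /= fh.
rewrite (splitr e) -[_ - h](subrKA f) (le_lt_trans (rnormD _ _))//.
rewrite addrC -addrC ler_ltD// rnormBC rnorm_domfun domnorm_le ?ltW// => x.
by rewrite domfunB near_g.
Qed.

HB.instance Definition _ :=
  Uniform_isComplete.Build (domfun D) domfun_cauchy_cvg.

End DomFunComplete.

(** * The Banach algebra of bounded operators *)

Section OperatorSpace.
Variables (R : realType) (E : completeNormedModType R[i]).

Definition is_linear_op : set (E -> E) :=
  [set T | forall k u v, T (k *: u + v) = k *: T u + T v].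

Fact is_linear_op0 : is_linear_op (fun=> 0).
Proof. by move=> k u v; rewrite scaler0 addr0. Qed.

Fact is_linear_op_lin (l : R[i]) S T : is_linear_op S -> is_linear_op T ->
  is_linear_op (fun x => l *: S x + T x).
Proof.
move=> Sl Tl k u v; rewrite Sl Tl !scalerDr !scalerA mulrC !addrA.
by congr (_ + _); rewrite -!addrA; congr (_ + _); rewrite addrC.
Qed.

Fact is_linear_op_lim (F : set_system (E -> E)) (T : E -> E) :
  ProperFilter F -> F is_linear_op ->
  (forall x, (fun S : E -> E => S x) @ F --> T x) -> is_linear_op T.
Proof.
move=> FF Fl FT k u v.
have lim2 : (fun S : E -> E => k *: S u + S v) @ F --> k *: T u + T v.
  by apply: cvgD; [apply: cvgZr; exact: FT|exact: FT].
apply: (@cvg_unique _ _ _ _ _ _ (FT (k *: u + v))).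
  exact: norm_hausdorff.
by apply: cvg_trans lim2; apply: near_eq_cvg; apply: filterS Fl => S; exact.
Qed.

Definition opspace : domspace E E :=
  DomSpace (@rnorm_ge0 R E) is_linear_op0 is_linear_op_lin is_linear_op_lim.

Implicit Types S T : domfun opspace.

Lemma op_linear T k u v : T (k *: u + v) = k *: T u + T v.
Proof. exact: (domfun_adm T). Qed.

Lemma opD T u v : T (u + v) = T u + T v.
Proof. by have := op_linear T 1 u v; rewrite !scale1r. Qed.

Lemma op0 T : T 0 = 0.
Proof. by apply: (addrI (T 0)); rewrite -opD !addr0. Qed.

Lemma opZ T k u : T (k *: u) = k *: T u.
Proof. by rewrite -[k *: u]addr0 op_linear op0 addr0. Qed.

Lemma op_norm T u : rnorm (T u) <= rnorm T * rnorm u.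
Proof. exact: domnormP. Qed.

Fact op_one_bound :
  exists2 M : R, 0 <= M & forall u : E, rnorm u <= M * weight opspace u.
Proof. by exists 1 => // u; rewrite mul1r. Qed.

Definition op_one : domfun opspace :=
  @DomFun _ _ _ opspace id (fun k u v => erefl) op_one_bound.

Fact op_mul_linear S T : is_linear_op (fun u => S (T u)).
Proof. by move=> k u v; rewrite !op_linear. Qed.

Fact op_mul_norm S T u : rnorm (S (T u)) <= rnorm S * rnorm T * rnorm u.
Proof.
by rewrite (le_trans (op_norm _ _))// -mulrA ler_wpM2l ?rnorm_ge0 ?op_norm.
Qed.

Fact op_mul_bound S T :
  exists2 M : R, 0 <= M & forall u, rnorm (S (T u)) <= M * weight opspace u.
Proof.
exists (rnorm S * rnorm T); first by rewrite mulr_ge0 ?rnorm_ge0.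
exact: op_mul_norm.
Qed.

Definition op_mul S T : domfun opspace :=
  @DomFun _ _ _ opspace (fun u => S (T u)) (op_mul_linear S T)
    (op_mul_bound S T).

Lemma op_mulE S T u : op_mul S T u = S (T u).
Proof. by []. Qed.

Fact op_mulA : associative op_mul.
Proof. by move=> S T U; apply: domfunP. Qed.

Fact op_mul1r : left_id op_one op_mul.
Proof. by move=> S; apply: domfunP. Qed.

Fact op_mulr1 : right_id op_one op_mul.
Proof. by move=> S; apply: domfunP. Qed.

Fact op_mulDl : left_distributive op_mul +%R.
Proof.
by move=> S T U; apply: domfunP => u; rewrite domfunD !op_mulE domfunD.
Qed.

Fact op_mulDr : right_distributive op_mul +%R.
Proof.
by move=> S T U; apply: domfunP => u; rewrite domfunD !op_mulE domfunD opD.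
Qed.

Fact op_scalerAl k S T : k *: op_mul S T = op_mul (k *: S) T.
Proof. by apply: domfunP => u; rewrite domfunZ !op_mulE domfunZ. Qed.

Fact op_scalerAr k S T : k *: op_mul S T = op_mul S (k *: T).
Proof. by apply: domfunP => u; rewrite domfunZ !op_mulE domfunZ opZ. Qed.

Fact op_norm_mul S T : `|op_mul S T| <= `|S| * `|T|.
Proof.
rewrite !rnormE -rmorphM lecR rnorm_domfun; apply: domnorm_le.
  by rewrite mulr_ge0 ?rnorm_ge0.
exact: op_mul_norm.
Qed.

Fact op_norm_one (e : E) : e != 0 -> `|op_one| = 1.
Proof.
move=> e0; have {}e0 : 0 < rnorm e.
  by rewrite lt0r rnorm_ge0 andbT; apply: contraNneq e0 => /rnorm0_eq0 ->.
rewrite rnormE; congr (_ %:C); apply/le_anti/andP; split.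
  by rewrite rnorm_domfun domnorm_le// => u; rewrite mul1r.
by rewrite -(ler_pM2r e0) mul1r; exact: op_norm op_one e.
Qed.

End OperatorSpace.

(** The identity has norm [1] only on a nonzero space, hence the nonzero vector
    among the parameters. *)
Definition operators (R : realType) (E : completeNormedModType R[i])
  (e : {e : E | e != 0}) : Type := domfun (opspace E).

HB.instance Definition _ (R : realType) (E : completeNormedModType R[i])
    (e : {e : E | e != 0}) :=
  CompleteNormedModule.copy (operators e) (domfun (opspace E)).

HB.instance Definition _ (R : realType) (E : completeNormedModType R[i])
    (e : {e : E | e != 0}) :=
  CompleteNormedModule_isBanachAlgebra.Build R[i] (operators e)
    (@op_mulA R E) (@op_mul1r R E) (@op_mulr1 R E)
    (@op_mulDl R E) (@op_mulDr R E) (@op_scalerAl R E) (@op_scalerAr R E)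
    (@op_norm_mul R E) (op_norm_one (svalP e)).

(** The ring operations are attached to the carriers of bundled Banach algebras;
    [opalg e] is the bundle whose carrier is [operators e]. *)
Definition opalg (R : realType) (E : completeNormedModType R[i])
  (e : {e : E | e != 0}) : banachAlgType R[i] := operators e.

Section OpAlg.
Variables (R : realType) (E : completeNormedModType R[i]).
Variable e : {e : E | e != 0}.
Implicit Types S T : opalg e.

Definition opapp S : E -> E := domfun_fun S.

Lemma opappM S T u : opapp (S * T) u = opapp S (opapp T u).
Proof. by []. Qed.

Lemma opappBZ l S u : opapp (l *: 1 - S) u = l *: u - opapp S u.
Proof. by rewrite /opapp domfunB domfunZ. Qed.

Lemma opapp0 S : opapp S 0 = 0.
Proof. exact: op0. Qed.

Lemma opapp_norm S u : rnorm (opapp S u) <= rnorm S * rnorm u.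
Proof. exact: op_norm. Qed.

Lemma opapp_norm_le S M : 0 <= M ->
  (forall u, rnorm (opapp S u) <= M * rnorm u) -> rnorm S <= M.
Proof. exact: domnorm_le. Qed.

End OpAlg.

(** * Inversion by the Neumann series *)

Lemma expr_small (R : realType) (q e : R) : 0 <= q < 1 -> 0 < e ->
  exists n, q ^+ n < e.
Proof.
move=> /andP[q0 q1] e0.
have /cvgrPdist_lt/(_ _ e0) : (fun n => q ^+ n) @ \oo --> (0 : R).
  by apply: cvg_expr; rewrite ger0_norm.
move=> /filter_ex[n]; rewrite sub0r normrN ger0_norm ?exprn_ge0// => qn.
by exists n.
Qed.

Section BanachAlgebraTheory.
Variables (R : realType) (A : banachAlgType R[i]).
Implicit Types u v x y z : A.

Lemma rnormM_le x y : rnorm (x * y) <= rnorm x * rnorm y.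
Proof. by rewrite -lecR rmorphM/= -!rnormE; exact: banach_norm_mul. Qed.

Lemma rnorm1 : rnorm (1 : A) = 1.
Proof. by rewrite /rnorm [`|_|]banach_norm_one. Qed.

Lemma rnormX_le x n : rnorm (x ^+ n) <= rnorm x ^+ n.
Proof.
elim: n => [|n IH]; first by rewrite !expr0 rnorm1.
by rewrite !exprS (le_trans (rnormM_le _ _))// ler_wpM2l ?rnorm_ge0.
Qed.

Lemma left_right_invertible x y z : x * y = 1 -> z * x = 1 -> invertible x.
Proof.
move=> xy zx; exists y; split => //.
by rewrite -[RHS]zx; congr (_ * _); rewrite -[LHS]mul1r -zx -mulrA xy mulr1.
Qed.

Lemma invertibleM x y : invertible x -> invertible y -> invertible (x * y).
Proof.
move=> [x' [xx' x'x]] [y' [yy' y'y]]; exists (y' * x'); split.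
  by rewrite mulrA -[x * y * y']mulrA yy' mulr1.
by rewrite mulrA -[y' * x' * x]mulrA x'x mulr1.
Qed.

Lemma invertibleZ (k : R[i]) x : k != 0 -> invertible x -> invertible (k *: x).
Proof.
move=> k0 [y [xy yx]]; exists (k^-1 *: y).
by rewrite -!scalerAl -!scalerAr !scalerA mulfV// mulVf// xy yx !scale1r.
Qed.

Lemma geometric_sum x n : (1 - x) * (\sum_(k < n) x ^+ k) = 1 - x ^+ n.
Proof. by rewrite -opprB mulNr -subrX1 opprB. Qed.

Lemma geometric_sumC x n : (\sum_(k < n) x ^+ k) * (1 - x) = 1 - x ^+ n.
Proof.
rewrite -geometric_sum; apply/commr_sym/commr_sum => i _.
apply/commrX/commr_sym.
by apply: commrB; [exact: commr1|exact: commr_refl].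
Qed.

(** The partial sums of [\sum_k u ^ k] form a Cauchy sequence, and their limit
    is a two-sided inverse because [(1 - u)] times a partial sum is
    [1 - u ^ n], on either side. *)
Lemma invertible_1B u : rnorm u < 1 -> invertible (1 - u).
Proof.
move=> u1; set q := rnorm u; have q0 : 0 <= q by exact: rnorm_ge0.
have q1 : 0 < 1 - q by rewrite subr_gt0.
pose s n := \sum_(k < n) u ^+ k.
have s_bound n : rnorm (s n) <= (1 - q)^-1.
  have: rnorm (s n) <= \sum_(k < n) q ^+ k.
    by rewrite (le_trans (rnorm_sum _ _))// ler_sum// => k _; exact: rnormX_le.
  move=> /le_trans; apply; rewrite -[leRHS]mul1r ler_pdivlMr// mulrC.
  by rewrite -opprB mulNr -subrX1 opprB lerBlDr lerDl exprn_ge0.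
have s_dist n m : (n <= m)%N -> rnorm (s n - s m) <= q ^+ n / (1 - q).
  move=> nm; have -> : s m = s n + u ^+ n * s (m - n)%N.
    rewrite /s -(subnKC nm) addKn big_split_ord/=; congr (_ + _).
    by rewrite mulr_sumr; apply: eq_bigr => k _; rewrite exprD.
  rewrite opprD addrA subrr add0r rnormN (le_trans (rnormM_le _ _))//.
  by rewrite ler_pM ?rnorm_ge0// rnormX_le.
have small e : 0 < e -> exists n, q ^+ n / (1 - q) < e.
  move=> e0; have [|n] := @expr_small R q (e * (1 - q)) _ (mulr_gt0 e0 q1).
    by rewrite q0.
  by rewrite -ltr_pdivrMr// => ?; exists n.
have [L sL] : exists L : A, s @ \oo --> L.
  apply/cvg_ex; apply: cauchy_cvg; apply/cauchy_rnormP => e e0.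
  have [n ne] := small _ e0; exists (s n).
  by exists n => // m /= nm; exact: le_lt_trans (s_dist _ _ nm) ne.
move/cvg_rnormP : sL => sL.
have lim e : 0 < e -> exists n, rnorm (L - s n) < e /\ rnorm (u ^+ n) < e.
  move=> e0; have [|n0 qe] := @expr_small R q e _ e0; first by rewrite q0.
  have [n1 _ s1] := sL _ e0; exists (maxn n0 n1); split.
    by apply: s1; rewrite /= leq_maxr.
  rewrite (le_lt_trans (rnormX_le _ _))// (le_lt_trans _ qe)//.
  by apply: ler_wiXn2l; rewrite ?q0 ?leq_maxl// ltW.
have close (y : A) : (forall e, 0 < e -> rnorm (y - 1) <= e) -> y = 1.
  move=> ye; apply/eqP; rewrite -subr_eq0; apply/eqP/rnorm0_eq0/le_anti.
  by rewrite rnorm_ge0 andbT; apply/ler_addgt0Pr => e e0; rewrite add0r ye.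
have B0 : 0 < rnorm (1 - u) + 1 by rewrite ltr_wpDl// rnorm_ge0.
have split_e e : rnorm (1 - u) * (e / (rnorm (1 - u) + 1)) +
    e / (rnorm (1 - u) + 1) = e.
  by rewrite -[X in _ + X]mul1r -mulrDl mulrC divfK// gt_eqF.
exists L; split; apply: close => e e0;
  have [n [Ln un]] := lim _ (divr_gt0 e0 B0).
- have -> : (1 - u) * L - 1 = (1 - u) * (L - s n) - u ^+ n.
    by rewrite mulrBr geometric_sum -addrA -opprD subrK.
  rewrite (le_trans (rnormB _ _))// -[leRHS]split_e lerD ?(ltW un)//.
  by rewrite (le_trans (rnormM_le _ _))// ler_wpM2l ?rnorm_ge0// ltW.
- have -> : L * (1 - u) - 1 = (L - s n) * (1 - u) - u ^+ n.
    by rewrite mulrBl geometric_sumC -addrA -opprD subrK.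
  rewrite (le_trans (rnormB _ _))// -[leRHS]split_e lerD ?(ltW un)//.
  by rewrite (le_trans (rnormM_le _ _))// mulrC ler_wpM2l ?rnorm_ge0// ltW.
Qed.

(** [1 - v] divides [1 - v ^ n] on both sides. *)
Lemma invertible_1B_pow v n : rnorm (v ^+ n) < 1 -> invertible (1 - v).
Proof.
move=> /invertible_1B[w [vw wv]].
apply: (@left_right_invertible _ ((\sum_(k < n) v ^+ k) * w)
                               (w * \sum_(k < n) v ^+ k)).
  by rewrite mulrA geometric_sum.
by rewrite -mulrA geometric_sumC.
Qed.

End BanachAlgebraTheory.

(** * The spectral radius *)

Section Resolvent.
Variables (R : realType) (A : banachAlgType R[i]) (y : A) (rho : R).
Variable res : R[i] -> A.
Hypothesis res_inv : forall l, rnorm l <= rho ->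
  (1 - l *: y) * res l = 1 /\ res l * (1 - l *: y) = 1.

Lemma resolvent_identity l m : rnorm l <= rho -> rnorm m <= rho ->
  res l - res m = (l - m) *: (res l * y * res m).
Proof.
move=> /res_inv[_ ll] /res_inv[mm _].
have -> : (l - m) *: (res l * y * res m) =
    res l * ((1 - m *: y) - (1 - l *: y)) * res m.
  have -> : (1 - m *: y) - (1 - l *: y) = (l - m) *: y.
    by rewrite opprB addrC subrKA scalerBl.
  by rewrite -scalerAr -scalerAl.
by rewrite mulrBr mulrBl ll mul1r -mulrA mm mulr1.
Qed.

Lemma resolvent_dist l m : rnorm l <= rho -> rnorm m <= rho ->
  rnorm (res l - res m) <=
    rnorm (l - m) * (rnorm (res l) * rnorm y * rnorm (res m)).
Proof.
move=> lr mr; rewrite resolvent_identity// rnormZ ler_wpM2l ?rnorm_ge0//.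
rewrite (le_trans (rnormM_le _ _))// ler_wpM2r ?rnorm_ge0//.
exact: rnormM_le.
Qed.

(** By the resolvent identity [|res l| <= |res l0| + c |l - l0| |res l|], with
    [c = |y| |res l0|]; near [l0] the last term is at most half of [|res l|].
    If [l0] is off the disc, a neighbourhood of [l0] avoids the disc. *)
Lemma resolvent_locally_bounded l0 : exists d B : R, [/\ 0 < d &
  forall l, rnorm l <= rho -> rnorm (l0 - l) < d -> rnorm (res l) <= B].
Proof.
have [l0r|l0r] := leP (rnorm l0) rho; last first.
  exists (rnorm l0 - rho), 0; split; first by rewrite subr_gt0.
  by move=> l lr ll0; have := le_lt_trans (ler_rnorm_dist l0 l) ll0; lra.
have yr0 : 0 <= rnorm y * rnorm (res l0) by rewrite mulr_ge0 ?rnorm_ge0.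
set c := rnorm y * rnorm (res l0) in yr0 *.
exists (2 * (c + 1))^-1, (2 * rnorm (res l0)); split.
  by rewrite invr_gt0 mulr_gt0// ltr_wpDl.
move=> l lr ll0.
have h : rnorm (l - l0) * c <= 2^-1.
  rewrite rnormBC (@le_trans _ _ ((2 * (c + 1))^-1 * c))//.
    by rewrite ler_wpM2r// ltW.
  by rewrite mulrC ler_pdivrMr; lra.
have := le_trans (ler_rnorm_dist _ _) (resolvent_dist lr l0r).
rewrite -mulrA -/c mulrCA.
have := ler_wpM2l (rnorm_ge0 (res l)) h; lra.
Qed.

(** A locally bounded function on a compact set is bounded.  The disc lies in
    the square of side [2 rho], compact as a product of two segments of [R]. *)
Lemma resolvent_bounded : exists B : R,
  forall l, rnorm l <= rho -> rnorm (res l) <= B.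
Proof.
pose P (B : R) (p : R * R) := rnorm (p.1 +i* p.2) <= rho ->
  rnorm (res (p.1 +i* p.2)) <= B.
pose K := (`[- rho, rho] `*` `[- rho, rho])%classic : set (R * R).
have /compact_near_coveringP : compact K.
  by apply: compact_setX; exact: segment_compact.
move=> /(_ _ (+oo%R : set_system R) P _)[|B [_ PB]].
  move=> [a b] _; have [d [B [d0 dB]]] := resolvent_locally_bounded (a +i* b).
  have d20 : 0 < d / 2 by rewrite divr_gt0.
  exists (ball (a, b) (d / 2), [set C | B < C]).
    by split; [exact: nbhsx_ballx|exists B; split => //; rewrite num_real].
  move=> [[a' b'] C] /= [[aa' bb'] BC] lr.
  apply: le_trans (ltW BC); apply: dB => //.
  by rewrite (le_lt_trans (rnorm_le_ReIm _))//= (splitr d) ltrD.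
exists (B + 1) => -[a b] lr.
have /= := PB (B + 1) _ (a, b).
apply=> //; first by rewrite ltrDl.
split; rewrite /= in_itv/= -ler_norml.
- exact: le_trans (Re_le_rnorm (a +i* b)) lr.
- exact: le_trans (Im_le_rnorm (a +i* b)) lr.
Qed.

Lemma resolvent_lipschitz : exists2 L : R, 0 <= L &
  forall l m, rnorm l <= rho -> rnorm m <= rho ->
    rnorm (res l - res m) <= L * rnorm (l - m).
Proof.
have [B resB] := resolvent_bounded.
have [B0|B0] := ltP B 0.
  exists 0 => // l m lr _; have := le_trans (rnorm_ge0 _) (resB _ lr).
  by rewrite leNgt B0.
exists (B * rnorm y * B); first by rewrite !mulr_ge0 ?rnorm_ge0.
move=> l m lr mr; rewrite (le_trans (resolvent_dist lr mr))// mulrC.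
rewrite ler_wpM2r ?rnorm_ge0//.
by rewrite ler_pM ?mulr_ge0 ?rnorm_ge0 ?resB// ler_wpM2r ?rnorm_ge0 ?resB.
Qed.

(** [G] is the average of the resolvent over the points [w l] with
    [w ^ (2 ^ n) = 1].  Doubling the number of points is the identity
    [2 (1 - u ^ 2)^-1 = (1 - u)^-1 + (1 + u)^-1], applied to
    [u = (l y) ^ (2 ^ n)]; multiplying [l] by a root [z] of [-1] of order
    [2 ^ n] turns [1 - u] into [1 + u] and stays in the disc.  An average of
    [L]-Lipschitz functions is [L]-Lipschitz: the constant does not depend
    on [n]. *)
Lemma resolvent_average (L : R) :
  (forall l m, rnorm l <= rho -> rnorm m <= rho ->
    rnorm (res l - res m) <= L * rnorm (l - m)) ->
  forall n, exists G : R[i] -> A,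
    (forall l, rnorm l <= rho ->
      G l * (1 - l ^+ (2 ^ n) *: y ^+ (2 ^ n)) = 1) /\
    (forall l m, rnorm l <= rho -> rnorm m <= rho ->
      rnorm (G l - G m) <= L * rnorm (l - m)).
Proof.
move=> resL; elim=> [|n [G [Ginv GL]]].
  by exists res; split => // l /res_inv[_]; rewrite !expr1.
set N := (2 ^ n)%N in Ginv *.
have N0 : (0 < N)%N by rewrite expn_gt0.
pose z : R[i] := N.-root (-1).
have zN : z ^+ N = -1 by rewrite rootCK.
have z1 : rnorm z = 1.
  apply/eqP; rewrite -(pexpr_eq1 N0) ?rnorm_ge0// -rnormX zN rnormN.
  by rewrite (rnorm_real (1 : R)) normr1.
have zr l : rnorm l <= rho -> rnorm (z * l) <= rho by rewrite rnormM z1 mul1r.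
exists (fun l => 2^-1 *: (G l + G (z * l))); split => [l lr|l m lr mr].
  have := Ginv _ lr; have := Ginv _ (zr _ lr).
  rewrite exprMn zN mulN1r scaleNr opprK expnS mulnC !exprM.
  set u := _ *: _ => Gz G1.
  have -> : (l ^+ N) ^+ 2 *: (y ^+ N) ^+ 2 = u ^+ 2 by rewrite exprZn.
  have uD : (1 - u) * (1 + u) = 1 - u ^+ 2.
    by rewrite mulrBl mul1r mulrDr mulr1 -expr2 opprD addrA addrK.
  have uB : (1 + u) * (1 - u) = 1 - u ^+ 2.
    by rewrite mulrDl mul1r mulrBr mulr1 -expr2 addrA subrK.
  rewrite -scalerAl mulrDl -{1}uD -uB !mulrA G1 Gz !mul1r addrACA subrr addr0.
  by rewrite -mulr2n -(scaler_nat 2 (1 : A)) scalerA mulVf ?scale1r// pnatr_eq0.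
rewrite -scalerBr opprD addrACA rnormZ.
have -> : rnorm (2^-1 : R[i]) = 2^-1.
  by rewrite -[2^-1 in RHS]ger0_norm// -rnorm_real fmorphV rmorph_nat.
have := GL _ _ lr mr; have := GL _ _ (zr _ lr) (zr _ mr).
rewrite -mulrBr rnormM z1 mul1r.
have := rnormD (G l - G m) (G (z * l) - G (z * m)); lra.
Qed.

End Resolvent.

(** If [u] is small then its [a = (1 - u)^-1] is near [1]; so is [b], which is
    near [a], and then [v] is controlled.  In numbers: [|a| <= 5 / 4],
    [|a - 1| = |a u| <= 1 / 4], [|b - 1| <= 1 / 2], and
    [v = (b - 1) - (b - 1) v]. *)
Lemma small_of_near_inverse (R : realType) (A : banachAlgType R[i])
    (a b u v : A) :
  a * (1 - u) = 1 -> b * (1 - v) = 1 ->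
  rnorm u <= 5^-1 -> rnorm (a - b) <= 4^-1 -> rnorm v <= 1.
Proof.
move=> au bv u5 ab.
have a1 : a - 1 = a * u by rewrite -[in RHS](subKr 1 u) mulrBr mulr1 au.
have a54 : rnorm a <= 5 / 4.
  have := rnormD (a - 1) 1; rewrite subrK a1 rnorm1.
  have := rnormM_le a u; have := ler_wpM2l (rnorm_ge0 a) u5; lra.
have aB : rnorm (a - 1) <= 4^-1.
  rewrite a1; have := rnormM_le a u; have := ler_wpM2l (rnorm_ge0 a) u5; lra.
have bB : rnorm (b - 1) <= 2^-1.
  have := rnormD (b - a) (a - 1); rewrite subrKA (rnormBC b a); lra.
have b1 : v = (b - 1) - (b - 1) * v.
  have bv1 : b * v = b - 1 by rewrite -[in RHS]bv mulrBr mulr1 subKr.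
  by rewrite mulrBl mul1r bv1 opprB addrC subrK.
have := rnormB (b - 1) ((b - 1) * v); rewrite -b1.
have := rnormM_le (b - 1) v; have := ler_wpM2r (rnorm_ge0 v) bB; lra.
Qed.

Section SpectralRadius.
Variables (R : realType) (A : banachAlgType R[i]) (y : A) (rho : R).
Hypothesis rho_gt0 : 0 < rho.
Hypothesis y_inv : forall l : R[i], rnorm l <= rho -> invertible (1 - l *: y).

(** Smallness of [s ^ N |y ^ N|] gives a bound at every [t] with
    [L (t - s) <= 1 / 4]: the inverses of [1 - (s y) ^ N] and [1 - (t y) ^ N]
    are averages of the resolvent at distance at most [L (t - s)]. *)
Lemma power_step : exists2 L : R, 0 <= L & forall (s t : R) n,
  0 <= s <= t -> t <= rho -> L * (t - s) <= 4^-1 ->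
  s ^+ (2 ^ n) * rnorm (y ^+ (2 ^ n)) <= 5^-1 ->
  t ^+ (2 ^ n) * rnorm (y ^+ (2 ^ n)) <= 1.
Proof.
have res_ex l : exists z, rnorm l <= rho ->
    (1 - l *: y) * z = 1 /\ z * (1 - l *: y) = 1.
  have [/y_inv[z zP]|lr] := leP (rnorm l) rho; first by exists z.
  by exists 0.
have [res resP] := choice res_ex.
have [L L0 resL] := resolvent_lipschitz resP.
exists L => // s t n /andP[s0 st] tr Lst sn.
have [G [G1 GL]] := resolvent_average resP resL n.
have rC (x : R) : 0 <= x -> rnorm x%:C = x.
  by move=> x0; rewrite rnorm_real ger0_norm.
have t0 := le_trans s0 st.
have Nrm (x : R) : 0 <= x -> rnorm (x%:C ^+ (2 ^ n) *: y ^+ (2 ^ n)) =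
    x ^+ (2 ^ n) * rnorm (y ^+ (2 ^ n)) by move=> x0; rewrite rnormZ rnormX rC.
have sr : rnorm s%:C <= rho by rewrite rC// (le_trans st).
have tr' : rnorm t%:C <= rho by rewrite rC.
rewrite -Nrm//.
apply: (small_of_near_inverse (G1 _ sr) (G1 _ tr')); first by rewrite Nrm.
by rewrite (le_trans (GL _ _ sr tr'))// rnormBC -raddfB rC ?subr_ge0.
Qed.

(** Cut [[0, rho]] into steps of length [h].  If [s ^ N |y ^ N|] is small at
    [s = i h], it is at most [1] at [(i + 2) h]; at [(i + 1) h] it is then
    bounded by a number less than [1], and a high enough power makes it small
    again. *)
Lemma spectral_radius_le :
  exists2 n, (0 < n)%N & rho ^+ n * rnorm (y ^+ n) <= 1.
Proof.
have [L L0 step] := power_step.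
(* so many steps that two of them, of length [rho / (K + 1)], stay within the
   range [1 / (4 L)] of [power_step] *)
have [K KL] : exists K : nat, 8 * rho * L < K%:R.
  by exists (Num.truncn (8 * rho * L)).+1; rewrite truncnS_gt.
pose h := rho / K.+1%:R.
have h0 : 0 < h by rewrite divr_gt0// ltr0n.
have Kh : rho = h * K.+1%:R by rewrite divfK// pnatr_eq0.
have Lh : L * (2 * h) <= 4^-1.
  by rewrite /h !mulrA ler_pdivrMr ?ltr0n// -natr1; lra.
have hM i j : (i <= j)%N -> h * i%:R <= h * j%:R.
  by move=> ij; rewrite ler_wpM2l ?(ltW h0)// ler_nat.
have h_ge0 i : 0 <= h * i%:R by rewrite mulr_ge0// ltW.
suff grow i : (i <= K)%N ->
    exists n, (h * i%:R) ^+ (2 ^ n) * rnorm (y ^+ (2 ^ n)) <= 5^-1.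
  have [n Kn] := grow _ (leqnn K).
  exists (2 ^ n)%N; first by rewrite expn_gt0.
  apply: step Kn => //; first by rewrite h_ge0 Kh hM.
  have -> : rho - h * K%:R = h by rewrite Kh -natr1 mulrDr mulr1 addrC addKr.
  by rewrite (le_trans _ Lh)// ler_wpM2l// mulr_natl mulr2n lerDl ltW.
elim: i => [_|i IH iK].
  by exists 0%N; rewrite mulr0 expr1 mul0r invr_ge0.
have [n ni] := IH (ltnW iK); set N := (2 ^ n)%N in ni.
pose t := h * i.+2%:R.
have t0 : 0 < t by rewrite mulr_gt0// ltr0n.
have tn : t ^+ N * rnorm (y ^+ N) <= 1.
  apply: step ni; first by rewrite h_ge0 hM// -addn2 leq_addr.
    by rewrite Kh hM.
  have -> : t - h * i%:R = 2 * h; last by [].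
  by rewrite /t -addn2 natrD mulrDr addrC addKr mulrC.
(* [p] is the ratio of the point [(i + 1) h] to [t = (i + 2) h], where the bound
   [1] is known: the powers of [p] provide the decay *)
pose p := h * i.+1%:R / t.
have p0 : 0 <= p by rewrite divr_ge0 ?h_ge0 ?ltW.
have p1 : p < 1 by rewrite ltr_pdivrMr// mul1r ltr_pM2l// ltr_nat.
have [m pm] : exists m, p ^+ m < 5^-1.
  by apply: expr_small; rewrite ?p0 ?invr_gt0.
exists (n + m)%N; rewrite expnD -/N.
have yNm : rnorm (y ^+ (N * 2 ^ m)) <= rnorm (y ^+ N) ^+ (2 ^ m).
  by rewrite exprM rnormX_le.
have -> : h * i.+1%:R = p * t by rewrite divfK// gt_eqF.
rewrite exprMn -mulrA (le_trans _ (ltW pm))//.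
have le1 : t ^+ (N * 2 ^ m) * rnorm (y ^+ (N * 2 ^ m)) <= 1.
  rewrite (@le_trans _ _ ((t ^+ N * rnorm (y ^+ N)) ^+ (2 ^ m)))//.
    rewrite [leRHS]exprMn -exprM; apply: ler_wpM2l yNm.
    by rewrite exprn_ge0 ?ltW.
  by rewrite exprn_ile1// mulr_ge0 ?rnorm_ge0// exprn_ge0// ltW.
rewrite (@le_trans _ _ (p ^+ (N * 2 ^ m)))//.
  by rewrite -[leRHS]mulr1 ler_wpM2l// exprn_ge0.
apply: ler_wiXn2l => //; first exact: ltW.
by rewrite (leq_trans (ltnW (ltn_expl m (ltnSn 1))))// leq_pmull// expn_gt0.
Qed.

End SpectralRadius.

(** * The translation on a weighted space of two-sided sequences *)

Section WeightedShift.
Variables (R : realType) (c : int -> R).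
Hypothesis c_gt0 : forall i, 0 < c i.
Hypothesis c0 : c 0 = 1.
Hypothesis cD : forall i j, c (i + j) <= c i * c j.

Fact wseq_lim (F : set_system (int -> cplane R)) (g : int -> cplane R) :
  ProperFilter F -> F setT ->
  (forall x, (fun f : int -> cplane R => f x) @ F --> g x) ->
  [set: int -> cplane R] g.
Proof. by []. Qed.

Definition wseq_space : domspace int (cplane R) :=
  DomSpace (fun i => ltW (c_gt0 i)) (admissible := setT) I
    (fun _ _ _ _ _ => I) wseq_lim.

Definition wseq : completeNormedModType R[i] := domfun wseq_space.

Lemma dominated_wseq (f : int -> cplane R) (M : R) : 0 <= M ->
  (forall i, rnorm (f i) <= M * c i) ->
  exists F : wseq, (forall i, domfun_fun F i = f i) /\ rnorm F <= M.
Proof.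
move=> M0 fM; exists (@DomFun _ _ _ wseq_space f I (ex_intro2 _ _ M M0 fM)).
by split => //; apply: domnorm_le.
Qed.

(** The weight itself, a vector of the unit ball at which all the translations
    attain their norms. *)
Lemma weight_vector_ex : exists F : wseq,
  (forall i, domfun_fun F i = (c i)%:C) /\ rnorm F <= 1.
Proof.
apply: dominated_wseq => // i; rewrite mul1r.
by rewrite [leLHS]rnorm_real gtr0_norm.
Qed.

Definition weight_vector : wseq := projT1 (cid weight_vector_ex).

Lemma weight_vectorE i : domfun_fun weight_vector i = (c i)%:C.
Proof. by rewrite /weight_vector; case: cid => F /= [+ _]; apply. Qed.

Lemma weight_vector_norm : rnorm weight_vector <= 1.
Proof. by rewrite /weight_vector; case: cid => F /= [_]. Qed.

Lemma weight_vector_neq0 : weight_vector != 0.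
Proof.
apply/eqP => w0; have := weight_vectorE 0; rewrite w0 c0 => /eqP.
by rewrite eq_sym oner_eq0.
Qed.

Definition wops : banachAlgType R[i] :=
  opalg (exist _ weight_vector weight_vector_neq0).

Section Translation.
Variable j : int.

Fact transl_bound (f : wseq) :
  exists2 M : R, 0 <= M &
    forall i, rnorm (domfun_fun f (i + j)) <= M * weight wseq_space i.
Proof.
exists (rnorm f * c j); first by rewrite mulr_ge0 ?rnorm_ge0 ?ltW.
move=> i; rewrite (le_trans (domnormP f _))// -mulrA ler_wpM2l ?domnorm_ge0//.
by rewrite mulrC cD.
Qed.

Definition transl (f : wseq) : wseq :=
  @DomFun _ _ _ wseq_space (fun i => domfun_fun f (i + j)) I (transl_bound f).

Lemma translE f i : domfun_fun (transl f) i = domfun_fun f (i + j).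
Proof. by []. Qed.

Fact transl_linear : is_linear_op transl.
Proof.
move=> k f g; apply: domfunP => i.
by rewrite domfunD domfunZ !translE domfunD domfunZ.
Qed.

Lemma transl_norm f : rnorm (transl f) <= c j * rnorm f.
Proof.
apply: domnorm_le => [|i]; first by rewrite mulr_ge0 ?rnorm_ge0 ?ltW.
rewrite translE (le_trans (domnormP f _))// [c j * _]mulrC -mulrA.
by rewrite ler_wpM2l ?domnorm_ge0// mulrC cD.
Qed.

Fact transl_opbound : exists2 M : R, 0 <= M &
  forall f, rnorm (transl f) <= M * weight (opspace wseq) f.
Proof. by exists (c j); [exact: ltW|exact: transl_norm]. Qed.

Definition wshift : wops :=
  @DomFun _ _ _ (opspace wseq) transl transl_linear transl_opbound.

Lemma wshiftE f i : domfun_fun (opapp wshift f) i = domfun_fun f (i + j).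
Proof. by []. Qed.

(** Submultiplicativity of [c] bounds the norm by [c j].  The weight vector
    attains it: the value at [0] of its translate is [c j], and the weight
    there is [c 0 = 1]. *)
Lemma wshift_norm : rnorm wshift = c j.
Proof.
apply/le_anti/andP; split.
  by apply: opapp_norm_le => [|f]; [exact: ltW|exact: transl_norm].
have := opapp_norm wshift weight_vector; rewrite -/wops => h.
have {}h : rnorm (opapp wshift weight_vector) <= rnorm wshift.
  rewrite (le_trans h)// -[leRHS]mulr1.
  by rewrite ler_wpM2l ?rnorm_ge0 ?weight_vector_norm.
have := domnormP (opapp wshift weight_vector) 0.
rewrite wshiftE add0r weight_vectorE/= c0 mulr1.
rewrite [leLHS]rnorm_real gtr0_norm//.
by move=> /le_trans; apply.
Qed.

End Translation.

Lemma wops_eq (S T : wops) :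
  (forall f i, domfun_fun (opapp S f) i = domfun_fun (opapp T f) i) -> S = T.
Proof. by move=> ST; apply: domfunP => f; apply: domfunP => i; exact: ST. Qed.

Lemma wshift0 : wshift 0 = 1.
Proof. by apply: wops_eq => f i; rewrite wshiftE addr0. Qed.

Lemma wshiftD i j : wshift (i + j) = wshift i * wshift j.
Proof. by apply: wops_eq => f k; rewrite opappM !wshiftE addrA. Qed.

Lemma wshiftX j (n : nat) : wshift j ^+ n = wshift (j * n%:Z).
Proof.
elim: n => [|n IH]; first by rewrite mulr0 wshift0.
by rewrite exprS IH -wshiftD intS mulrDr mulr1.
Qed.

Variable r : R.
Hypothesis r_gt0 : 0 < r.
Hypothesis c_ge : forall i, r ^ i <= c i.
Hypothesis c_lt_pow : forall t, r < t -> exists n : nat, c n < t ^+ n.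
Hypothesis c_opp_lt_pow :
  forall t, 0 < t < r -> exists n : nat, t ^+ n * c (- n%:Z) < 1.

(** The sequence [l ^ i] lies in the space, since [r ^ i <= c i], and is killed
    by [l - S]. *)
Lemma wshift_eigenvalue (l : R[i]) :
  rnorm l = r -> ~ invertible (l *: 1 - wshift 1).
Proof.
move=> lr [T [_ TS]].
have l0 : l != 0 by apply: contraTneq r_gt0 => l0; rewrite -lr l0 rnorm0 ltxx.
have rl (i : int) : rnorm (l ^ i : cplane R) = r ^ i by rewrite [LHS]rnormXz lr.
have [|F [FE _]] := @dominated_wseq (fun i => l ^ i) 1 ler01.
  by move=> i; rewrite mul1r rl.
have SF : opapp (l *: 1 - wshift 1) F = 0.
  apply: domfunP => i; rewrite opappBZ domfunB domfunZ wshiftE !FE.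
  by rewrite (expfzDr _ _ l0) expr1z mulrC subrr.
have F0 : opapp (1 : wops) F = F by [].
rewrite -TS opappM SF opapp0 in F0.
have := FE 0; rewrite -F0 expr0z => /eqP.
by rewrite eq_sym oner_eq0.
Qed.

Lemma wshift_spectrum :
  spectrum (wshift 1) = [set l : R[i] | `|l| = r%:C].
Proof.
apply/seteqP; split=> l /=; last first.
  by rewrite rnormE => /complexI; exact: wshift_eigenvalue.
apply: contra_notP => lr.
have {lr} : rnorm l != r.
  by apply/eqP => lr'; apply: lr; rewrite rnormE lr'.
rewrite neq_lt => /orP[lr|rl].
(* inside the circle, the series runs over the powers of the inverse of [S] *)
- have -> : l *: 1 - wshift 1 = (-1) *: (wshift 1 * (1 - l *: wshift (-1))).
    rewrite mulrBr mulr1 -scalerAr -wshiftD subrr wshift0.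
    by rewrite scaleN1r opprB.
  apply: invertibleZ; first by rewrite oppr_eq0 oner_eq0.
  apply: invertibleM.
    by exists (wshift (-1)); rewrite -!wshiftD subrr addNr wshift0.
  have [l0|l0] := eqVneq (rnorm l) 0.
    by apply: (@invertible_1B_pow _ _ _ 1); rewrite expr1 rnormZ l0 mul0r.
  have [|n ln] := c_opp_lt_pow (t := rnorm l).
    by rewrite lt0r l0 rnorm_ge0.
  apply: (@invertible_1B_pow _ _ _ n).
  by rewrite exprZn rnormZ rnormX wshiftX mulN1r wshift_norm.
- have l0 : l != 0.
    by apply: contraTneq rl => ->; rewrite rnorm0 -leNgt ltW.
  have -> : l *: 1 - wshift 1 = l *: (1 - l^-1 *: wshift 1).
    by rewrite scalerBr scalerA mulfV// scale1r.
  apply: invertibleZ => //.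
  have [n nl] := c_lt_pow rl; apply: (@invertible_1B_pow _ _ _ n).
  have L0 : 0 < rnorm l by exact: lt_trans rl.
  rewrite exprZn rnormZ rnormX wshiftX mul1r wshift_norm mulrC.
  by rewrite rnormV exprVn ltr_pdivrMr ?exprn_gt0// mul1r.
Qed.

End WeightedShift.

(** * Submultiplicative sequences and the numbers [C_i] *)

(** Indexing by pairs [(m, n)] with [n = m + i] removes the absolute value and
    treats both signs of [i] alike. *)
Lemma shift_sup_le (R : realType) (a : nat -> R) (i : int) (M : R) :
  (forall n, 0 < a n) ->
  (shift_sup a i <= M%:E)%E <->
  (forall m n : nat, n%:Z = m%:Z + i -> a n <= M * a m).
Proof.
move=> a_gt0; split=> [iM m n nm|aM].
  rewrite -ler_pdivrMr// -lee_fin (le_trans _ iM)//.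
  by apply: ereal_sup_ubound; exists m; rewrite /= -nm.
apply: ge_ereal_sup => _ [m /= mi <-]; rewrite lee_fin ler_pdivrMr//.
by apply: aM; rewrite gez0_abs.
Qed.

Section Sequence.
Variables (R : realType) (a : nat -> R) (r : R).
Hypothesis a_gt0 : forall n : nat, 0 < a n.
Hypothesis a0 : a 0%N = 1.
Hypothesis aD : forall i j : nat, a (i + j)%N <= a i * a j.
Hypothesis a_lim : (fun n : nat => a n `^ (n%:R)^-1) @ \oo --> r.
Hypothesis r_gt0 : 0 < r.

Lemma powR_root (x : R) (n : nat) : (0 < n)%N -> 0 <= x ->
  (x `^ n%:R^-1) ^+ n = x.
Proof.
move=> n0 x0; rewrite -powR_mulrn ?powR_ge0// -powRrM mulVf ?powRr1//.
by rewrite pnatr_eq0 -lt0n.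
Qed.

Lemma eventually_gt_pow (s : R) : 0 <= s < r ->
  exists N, forall n, (N < n)%N -> s ^+ n < a n.
Proof.
move=> /andP[s0 sr]; have rs : 0 < r - s by rewrite subr_gt0.
have /cvgrPdist_lt/(_ _ rs)[N _ Nn] := a_lim.
exists N => n Nltn; have n0 : (0 < n)%N by exact: leq_ltn_trans Nltn.
have /= h := Nn _ (ltnW Nltn); rewrite -(powR_root n0 (ltW (a_gt0 n))).
rewrite ltrXn2r ?nnegrE ?powR_ge0// -?lt0n//.
by have := ler_norm (r - a n `^ n%:R^-1); lra.
Qed.

Lemma eventually_lt_pow (s : R) : r < s ->
  exists N, forall n, (N < n)%N -> a n < s ^+ n.
Proof.
move=> sr; have rs : 0 < s - r by rewrite subr_gt0.
have /cvgrPdist_lt/(_ _ rs)[N _ Nn] := a_lim.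
have s0 : 0 <= s by rewrite ltW// (lt_trans r_gt0).
exists N => n Nltn; have n0 : (0 < n)%N by exact: leq_ltn_trans Nltn.
have /= h := Nn _ (ltnW Nltn); rewrite -(powR_root n0 (ltW (a_gt0 n))).
rewrite ltrXn2r ?nnegrE ?powR_ge0// -?lt0n//.
by move: h; rewrite distrC; have := ler_norm (a n `^ n%:R^-1 - r); lra.
Qed.

Lemma submult_pow n k : a (n * k) <= a n ^+ k.
Proof.
elim: k => [|k IH]; first by rewrite muln0 expr0 a0.
by rewrite mulnS exprS (le_trans (aD _ _))// ler_wpM2l// ltW.
Qed.

(** Fekete: if [a n = s ^ n] with [s < r], then submultiplicativity gives
    [a (n k) <= s ^ (n k)] for all [k], against the limit. *)
Lemma root_limit_pow_le n : r ^+ n <= a n.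
Proof.
case: n => [|n]; first by rewrite a0 expr0.
rewrite leNgt; apply/negP => arn.
pose s := a n.+1 `^ n.+1%:R^-1.
have sn : s ^+ n.+1 = a n.+1 by rewrite powR_root// ltW.
have s0 : 0 <= s by exact: powR_ge0.
have sr : s < r by rewrite -(@ltr_pXn2r _ n.+1) ?nnegrE ?(ltW r_gt0)// sn.
have [|N aN] := @eventually_gt_pow s; first by rewrite s0.
have := aN (n.+1 * N.+1)%N; rewrite ltNge exprM sn submult_pow => h.
by suff : false by []; apply: h; rewrite (leq_trans (ltnSn N))// leq_pmull.
Qed.

(** Iterating the hypothesis from [a 0 = 1] gives [1 <= M ^ j a (k j)]; if [M]
    were [s ^ (- k)] with [s > r], then [a (k j) >= s ^ (k j)] would contradict
    the limit. *)
Lemma backward_bound_ge (k : nat) (M : R) : (0 < k)%N ->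
  (forall m : nat, a m <= M * a (m + k)%N) -> (r^-1) ^+ k <= M.
Proof.
move=> k0 aM; have M0 : 0 < M.
  have := aM 0%N; rewrite a0 add0n => h.
  by rewrite -(pmulr_lgt0 _ (a_gt0 k)) (lt_le_trans _ h).
have powM j : 1 <= M ^+ j * a (k * j)%N.
  elim: j => [|j IH]; first by rewrite muln0 a0 mulr1.
  rewrite (le_trans IH)// exprSr -mulrA ler_wpM2l ?exprn_ge0 ?(ltW M0)//.
  by rewrite mulnSr aM.
rewrite leNgt; apply/negP => Mr.
pose s := M^-1 `^ k%:R^-1.
have sk : s ^+ k = M^-1 by rewrite powR_root// invr_ge0 ltW.
have rs : r < s.
  rewrite -(@ltr_pXn2r _ k) ?nnegrE ?powR_ge0 ?(ltW r_gt0)// sk.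
  by rewrite -[r]invrK exprVn ltf_pV2 ?posrE ?exprn_gt0 ?invr_gt0.
have [N aN] := eventually_lt_pow rs.
have : a (k * N.+1)%N < s ^+ (k * N.+1)%N.
  by apply: aN; rewrite (leq_trans (ltnSn N))// leq_pmull.
rewrite exprM sk exprVn -[X in _ < X]mulr1 ltr_pdivlMl ?exprn_gt0//.
by rewrite ltNge powM.
Qed.

Lemma shift_sup_ge (k : nat) : (0 < k)%N ->
  (((r^-1) ^+ k)%:E <= shift_sup a (- k%:Z))%E.
Proof.
move=> k0.
have ge (M : R) : (shift_sup a (- k%:Z) <= M%:E)%E -> (r^-1) ^+ k <= M.
  move/(shift_sup_le _ _ a_gt0) => aM; apply: backward_bound_ge => // m.
  by apply: aM; rewrite PoszD addrK.
case E : (shift_sup a (- k%:Z)) ge => [M| |] ge; first by rewrite lee_fin ge.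
  by rewrite leey.
have := ge 0 (leNye _); rewrite leNgt exprn_gt0//.
by rewrite invr_gt0.
Qed.

(** Real powers are monotone on nonnegative arguments only, and
    [C_(-k) >= r ^ (- k)] ensures that [C_(-k)] is one. *)
Lemma shift_sup_root_le (k : nat) (s : R) : (0 < k)%N -> 0 <= s ->
  ((shift_sup a (- k%:Z) `^ (k%:R)^-1)%E <= s%:E)%E <->
  (shift_sup a (- k%:Z) <= (s ^+ k)%:E)%E.
Proof.
move=> k0 s0; have rk : 0 <= (r^-1) ^+ k by rewrite exprn_ge0// invr_ge0 ltW.
have := shift_sup_ge k0; case: (shift_sup a (- k%:Z)) => [M| |].
- rewrite poweR_EFin !lee_fin => /(le_trans rk) M0.
  by rewrite -[in X in _ <-> X](powR_root k0 M0) ler_pXn2r ?nnegrE ?powR_ge0.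
- by rewrite poweRyr ?gt_eqF ?invr_gt0 ?ltr0n.
- by rewrite leNgt ltNyr.
Qed.

End Sequence.

(** * From the spectrum to the numbers [C_(-k)] *)

Section Necessity.
Variables (R : realType) (a : nat -> R) (r : R).
Hypothesis a_gt0 : forall n : nat, 0 < a n.
Hypothesis a0 : a 0%N = 1.
Hypothesis a_lim : (fun n : nat => a n `^ (n%:R)^-1) @ \oo --> r.
Hypothesis r_gt0 : 0 < r.
Variables (A : banachAlgType R[i]) (x : A).
Hypothesis x_norm : forall n : nat, `|x ^+ n| = (a n)%:C.
Hypothesis x_spec : spectrum x = [set l : R[i] | `|l| = r%:C].

Lemma off_circle_invertible (l : R[i]) :
  rnorm l != r -> invertible (l *: 1 - x).
Proof.
move=> lr; apply: contrapT => nl.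
have : spectrum x l by [].
by rewrite x_spec /= rnormE => /complexI e; rewrite e eqxx in lr.
Qed.

Lemma spectrum_circle_inverse : exists y : A, x * y = 1 /\ y * x = 1.
Proof.
have [|z []] := @off_circle_invertible 0; first by rewrite rnorm0 lt_eqF.
rewrite scale0r add0r mulNr mulrN => xz zx.
by exists (- z); rewrite mulrN mulNr.
Qed.

Lemma spectrum_circle_shift_sup :
  (shift_sup a (-1) \is a fin_num /\
   ereal_inf [set (shift_sup a (- k%:Z) `^ (k%:R)^-1)%E
             | k in [set k : nat | (0 < k)%N]] = (r^-1)%:E).
Proof.
have [y [xy yx]] := spectrum_circle_inverse.
have xn n : rnorm (x ^+ n) = a n.
  by apply: complexI; rewrite -rnormE x_norm.
have yx_comm : GRing.comm y x by rewrite /GRing.comm yx xy.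
have yxX k : y ^+ k * x ^+ k = 1 by rewrite -exprMn_comm// yx expr1n.
have supy k : (shift_sup a (- k%:Z) <= (rnorm (y ^+ k))%:E)%E.
  apply/(shift_sup_le _ _ a_gt0) => m n nm.
  have -> : m = (k + n)%N.
    by apply/eqP; rewrite -eqz_nat PoszD nm addrC subrK.
  rewrite -!xn exprD; have := rnormM_le (y ^+ k) (x ^+ k * x ^+ n).
  by rewrite mulrA yxX mul1r.
have ge k : (0 < k)%N -> ((r^-1 ^+ k)%:E <= shift_sup a (- k%:Z))%E.
  exact: (shift_sup_ge a_gt0 a0 a_lim r_gt0).
split.
  rewrite fin_numE; apply/andP; split; apply/eqP => E.
    by have := ge 1%N isT; rewrite E leNgt ltNyr.
  by have := supy 1%N; rewrite E leNgt ltry.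
apply/eqP; rewrite eq_le; apply/andP; split; last first.
  apply: le_ereal_inf_tmp => _ [k /= k0 <-].
  have := ge _ k0; case E : (shift_sup a _) => [M| |].
  - rewrite poweR_EFin !lee_fin => rM.
    have ri : 0 <= r^-1 by rewrite invr_ge0 ltW.
    have M0 : 0 <= M by rewrite (le_trans _ rM)// exprn_ge0.
    by rewrite -(@ler_pXn2r _ k) ?nnegrE ?powR_ge0// powR_root.
  - by rewrite poweRyr ?leey// invr_neq0// pnatr_eq0 -lt0n.
  - by rewrite leNgt ltNyr.
apply/lee_addgt0Pr => e e0; rewrite -EFinD.
have re0 : 0 < r^-1 + e by rewrite addr_gt0 ?invr_gt0.
(* the radius below [r] for which the spectral bound reads [1 / r + e] *)
pose rho := (r^-1 + e)^-1.
have rho0 : 0 < rho by rewrite invr_gt0.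
have rho_r : rho < r.
  by rewrite -[ltRHS]invrK ltf_pV2 ?posrE ?invr_gt0// ltrDl.
have [|n n0 yn] := @spectral_radius_le _ _ y rho rho0.
  move=> l lrho; have -> : 1 - l *: y = (-1) *: ((l *: 1 - x) * y).
    by rewrite mulrBl -scalerAl mul1r xy scaleN1r opprB.
  apply: invertibleZ; first by rewrite oppr_eq0 oner_eq0.
  apply: invertibleM; last by exists x.
  by apply: off_circle_invertible; rewrite lt_eqF// (le_lt_trans lrho).
apply: (@le_trans _ _ (shift_sup a (- n%:Z) `^ (n%:R)^-1)%E).
  by apply: ereal_inf_lbound; exists n.
apply/(shift_sup_root_le a_gt0 a0 a_lim r_gt0) => //; first exact: ltW.
apply: le_trans (supy n) _; rewrite lee_fin.
by rewrite -[r^-1 + e]invrK -/rho exprVn -[leRHS]mulr1 ler_pdivlMl ?exprn_gt0.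
Qed.

End Necessity.

(** * From the numbers [C_i] to the spectrum *)

Section Sufficiency.
Variables (R : realType) (a : nat -> R) (r : R).
Hypothesis a_gt0 : forall n : nat, 0 < a n.
Hypothesis a0 : a 0%N = 1.
Hypothesis aD : forall i j : nat, a (i + j)%N <= a i * a j.
Hypothesis a_lim : (fun n : nat => a n `^ (n%:R)^-1) @ \oo --> r.
Hypothesis r_gt0 : 0 < r.
Hypothesis sup_fin : shift_sup a (-1) \is a fin_num.
Hypothesis sup_inf : ereal_inf [set (shift_sup a (- k%:Z) `^ (k%:R)^-1)%E
             | k in [set k : nat | (0 < k)%N]] = (r^-1)%:E.

Let c (i : int) : R := fine (shift_sup a i).

(** [C_i <= a i] for [i >= 0], and [C_(-k) <= C_(-1) ^ k]: this is where the
    finiteness of [C_(-1)] is used. *)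
Lemma shift_sup_bounded (i : int) : exists M : R, (shift_sup a i <= M%:E)%E.
Proof.
case: i => k.
  exists (a k); apply/(shift_sup_le _ _ a_gt0) => m n nm.
  have -> : n = (k + m)%N by apply/eqP; rewrite -eqz_nat nm PoszD addrC.
  exact: aD.
exists (fine (shift_sup a (-1)) ^+ k.+1).
apply/(shift_sup_le _ _ a_gt0) => m n nm.
have step j : a j <= fine (shift_sup a (-1)) * a j.+1.
  have /(shift_sup_le _ _ a_gt0) :
      (shift_sup a (-1) <= (fine (shift_sup a (-1)))%:E)%E by rewrite fineK.
  by apply; rewrite intS addrC addKr.
have -> : m = (n + k.+1)%N.
  by apply/eqP; rewrite -eqz_nat PoszD nm NegzE subrK.
have C0 : 0 <= fine (shift_sup a (-1)).
  by rewrite -(pmulr_lge0 _ (a_gt0 1)) (le_trans _ (step 0%N))// ltW.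
elim: k.+1 => [|j IH]; first by rewrite addn0 expr0 mul1r.
rewrite (le_trans IH)// exprSr -mulrA ler_wpM2l ?exprn_ge0// addnS.
exact: step.
Qed.

Lemma shift_sup_pos (i : int) : (0 < shift_sup a i)%E.
Proof.
have ub m n : n%:Z = m%:Z + i -> (0 < shift_sup a i)%E.
  move=> nm; apply: (@lt_le_trans _ _ (a n / a m)%:E).
    by rewrite lte_fin divr_gt0.
  by apply: ereal_sup_ubound; exists m; rewrite /= -nm.
case: i ub => k ub; first by apply: (ub 0%N k); rewrite add0r.
by apply: (ub k.+1 0%N); rewrite NegzE subrr.
Qed.

Lemma c_fin i : (c i)%:E = shift_sup a i.
Proof.
rewrite /c fineK//; have [M iM] := shift_sup_bounded i.
by rewrite ge0_fin_numE ?ltW ?shift_sup_pos// (le_lt_trans iM)// ltry.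
Qed.

Lemma c_pos i : 0 < c i.
Proof. by rewrite -lte_fin c_fin shift_sup_pos. Qed.

Lemma c_bound (m n : nat) (i : int) : n%:Z = m%:Z + i -> a n <= c i * a m.
Proof.
have /(shift_sup_le _ _ a_gt0) : (shift_sup a i <= (c i)%:E)%E by rewrite c_fin.
by apply.
Qed.

Lemma c_le (i : int) (M : R) :
  (forall m n : nat, n%:Z = m%:Z + i -> a n <= M * a m) -> c i <= M.
Proof.
by move=> aM; rewrite -lee_fin c_fin; apply/(shift_sup_le _ _ a_gt0).
Qed.

Lemma c_nat (n : nat) : c n = a n.
Proof.
apply/le_anti/andP; split.
  apply: c_le => m n' nm.
  have -> : n' = (n + m)%N by apply/eqP; rewrite -eqz_nat nm PoszD addrC.
  exact: aD.
by have := @c_bound 0%N n n; rewrite a0 mulr1 add0r; apply.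
Qed.

(** [a (m + i + j) / a m] factors through [a (m + i)] or through [a (m + j)]:
    one of the two indices is nonnegative when [m] and [m + i + j] are. *)
Lemma c_subM (i j : int) : c (i + j) <= c i * c j.
Proof.
apply: c_le => m n nm.
have mid (p : nat) (k l : int) : p%:Z = m%:Z + k -> n%:Z = p%:Z + l ->
    a n <= c k * c l * a m.
  move=> pm np; rewrite (le_trans (c_bound np))// [c k * _]mulrC -mulrA.
  by rewrite ler_wpM2l ?c_bound// ltW ?c_pos.
have [ge|lt] := leP 0 (m%:Z + i).
  apply: (@mid `|(m%:Z + i)%R|%N i j); first by rewrite gez0_abs.
  by rewrite gez0_abs// nm addrA.
rewrite [c i * _]mulrC; apply: (@mid `|(m%:Z + j)%R|%N j i).
  by rewrite gez0_abs//; lia.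
by rewrite gez0_abs; lia.
Qed.

Lemma c_ge (i : int) : r ^ i <= c i.
Proof.
case: i => k; first by rewrite c_nat; exact: root_limit_pow_le a_lim r_gt0 k.
rewrite NegzE -exprnN -exprVn -lee_fin c_fin.
exact: (shift_sup_ge a_gt0 a0 a_lim r_gt0).
Qed.

Lemma c_small_pos (t : R) : r < t -> exists n : nat, c n < t ^+ n.
Proof.
move=> rt; have [N aN] := eventually_lt_pow a_gt0 a_lim r_gt0 rt.
by exists N.+1; rewrite c_nat aN.
Qed.

Lemma c_small_neg (t : R) :
  0 < t < r -> exists n : nat, t ^+ n * c (- n%:Z) < 1.
Proof.
move=> /andP[t0 tr].
have : (ereal_inf [set (shift_sup a (- k%:Z) `^ (k%:R)^-1)%E
             | k in [set k : nat | (0 < k)%N]] < (t^-1)%:E)%E.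
  by rewrite sup_inf lte_fin ltf_pV2.
move/ereal_inf_lt => [_ [k /= k0 <-]]; rewrite -c_fin poweR_EFin lte_fin => ct.
exists k; rewrite -ltr_pdivlMl ?exprn_gt0// mulr1 -exprVn.
have ck : 0 <= c (- k%:Z) by rewrite ltW ?c_pos.
by rewrite -(powR_root k0 ck) ltrXn2r ?nnegrE ?powR_ge0// -?lt0n// invr_ge0 ltW.
Qed.

Lemma shift_sup_spectrum_circle : exists (A : banachAlgType R[i]) (x : A),
     (forall n : nat, `|x ^+ n| = (a n)%:C) /\
     spectrum x = [set l : R[i] | `|l| = r%:C].
Proof.
have c0 : c 0 = 1 by rewrite (c_nat 0).
exists (wops c_pos c0), (wshift c_pos c0 c_subM 1); split=> [n|].
  by rewrite rnormE wshiftX mul1r wshift_norm c_nat.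
exact: wshift_spectrum r_gt0 c_ge c_small_pos c_small_neg.
Qed.

End Sufficiency.

Theorem corollary2p14 (R : realType) (a : nat -> R) (r : R)
    (a_gt0 : forall n : nat, 0 < a n)
    (a0 : a 0%N = 1)
    (aD : forall i j : nat, a (i + j)%N <= a i * a j)
    (a_lim : (fun n : nat => a n `^ (n%:R)^-1) @ \oo --> r)
    (r_gt0 : 0 < r) :
  (exists (A : banachAlgType R[i]) (x : A),
     (forall n : nat, `|x ^+ n| = (a n)%:C) /\
     spectrum x = [set l : R[i] | `|l| = r%:C])
  <->
  (shift_sup a (-1) \is a fin_num /\
   ereal_inf [set (shift_sup a (- k%:Z) `^ (k%:R)^-1)%E
             | k in [set k : nat | (0 < k)%N]] = (r^-1)%:E).
Proof.
split=> [[A [x [xn xs]]]|[sf si]].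
  exact: spectrum_circle_shift_sup a_gt0 a0 a_lim r_gt0 A x xn xs.
exact: shift_sup_spectrum_circle.
Qed.
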